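(* Let $n\ge 1$, $q\in\mathbb C^*$, let $A$ be the $n\times n$ matrix with all entries $a_{i,j}=1$, and let $\lambda_a=q^a$, $\mu_b=q^b$ for all $a,b\in\mathbb Z$. Then $$|A|_{\lambda,\mu}=\prod_{m=1}^{\lfloor n/2\rfloor}\ \prod_{j=2m-n}^{n-2m}(1+q^j).$$
   Context: Generalized Lambda-determinant: given $A=(a_{r,c})_{1\le r,c\le n}$ and parameters $(\lambda_a),(\mu_a)$, define $T_{i,j,k}$ for $i,j\in\mathbb Z$, $k\ge 0$, $i+j+k\equiv n \pmod 2$, by $T_{i,j,0}=1$ ($i+j\equiv n$ mod 2), $T_{i,j,1}=a_{\frac{j-i+n+1}{2},\frac{i+j+n+1}{2}}$ ($i+j\equiv n+1$ mod 2, $|i|+|j|\le n-1$), and $T_{i,j,k+1}T_{i,j,k-1}=\mu_j\,T_{i,j+1,k}T_{i,j-1,k}+\lambda_i\,T_{i+1,j,k}T_{i-1,j,k}$. Then $|A|_{\lambda,\mu}:=T_{0,0,n}$ (determined by the data with $|i|+|j|\le n-1$). *)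

(* Defs.v *)
From mathcomp Require Import all_boot all_order all_algebra.
From mathcomp Require Import fraction mpoly complex reals zify.

Set Implicit Arguments.
Unset Strict Implicit.
Unset Printing Implicit Defensive.

Import Order.TTheory GRing.Theory Num.Theory.

Local Open Scope ring_scope.

(* 1-based access to the entry a_{r,c}.  The default value 1 is only used for
   (r, c) outside [1, n]^2, where the T-system has no prescribed datum. *)
Definition entry (K : fieldType) (n : nat) (A : 'M[K]_n) (r c : int) : K :=
  match insub (absz (r - 1)), insub (absz (c - 1)) with
  | Some r', Some c' => A r' c'
  | _, _ => 1
  end.

(* T_{i,j,k}, with the recurrence solved for T_{i,j,k+1}.  Only the values with
   i + j + k = n mod 2 and |i| + |j| + k <= n are meaningful (and these only
   involve one another); the others are arbitrary.  The division is harmless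
   where Tsys is used below, namely for generic data: see Tgen_neq0 and
   Tgen_recurrence. *)
Fixpoint Tsys (K : fieldType) (n : nat) (A : 'M[K]_n) (lam mu : int -> K)
    (i j : int) (k : nat) {struct k} : K :=
  match k with
  | 0 => 1
  | 1 => entry A ((j - i + n%:Z + 1) %/ 2)%Z ((i + j + n%:Z + 1) %/ 2)%Z
  | (k'.+1 as k1).+1 =>
      (mu j * Tsys A lam mu i (j + 1) k1 * Tsys A lam mu i (j - 1) k1
       + lam i * Tsys A lam mu (i + 1) j k1 * Tsys A lam mu (i - 1) j k1)
      / Tsys A lam mu i j k'
  end.

Lemma TsysSS (K : fieldType) (n : nat) (A : 'M[K]_n) (lam mu : int -> K)
    (i j : int) (k : nat) :
  Tsys A lam mu i j k.+2 =
    (mu j * Tsys A lam mu i (j + 1) k.+1 * Tsys A lam mu i (j - 1) k.+1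
     + lam i * Tsys A lam mu (i + 1) j k.+1 * Tsys A lam mu (i - 1) j k.+1)
    / Tsys A lam mu i j k.
Proof. by []. Qed.

(* Names of the independent data: the entries a_{r,c}, and the parameters
   lambda_a, mu_a with |a| <= n, where a is stored as a + n.  (T_{0,0,n} only
   involves those with |a| <= n - 2.) *)
Definition datum (n : nat) : finType :=
  ('I_n * 'I_n + ('I_n.*2.+1 + 'I_n.*2.+1))%type.

Notation genpoly C n := {mpoly C[#|datum n|]}.
Notation genfrac C n := {fraction genpoly C n}.

Definition gen (C : fieldType) (n : nat) (d : datum n) : genfrac C n :=
  FracField.tofrac ('X_(enum_rank d) : genpoly C n).

Definition gen_mx (C : fieldType) (n : nat) : 'M[genfrac C n]_n :=
  \matrix_(r, c) gen C (inl (r, c) : datum n).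

Definition gen_lam (C : fieldType) (n : nat) (a : int) : genfrac C n :=
  gen C (inr (inl (inord (absz (a + n%:Z)))) : datum n).

Definition gen_mu (C : fieldType) (n : nat) (a : int) : genfrac C n :=
  gen C (inr (inr (inord (absz (a + n%:Z)))) : datum n).

Definition Tgen (C : fieldType) (n : nat) (i j : int) (k : nat) : genfrac C n :=
  Tsys (gen_mx C n) (@gen_lam C n) (@gen_mu C n) i j k.

Definition datum_val (C : fieldType) (n : nat) (A : 'M[C]_n)
    (lam mu : int -> C) (d : datum n) : C :=
  match d with
  | inl (r, c) => A r c
  | inr (inl a) => lam (a%:Z - n%:Z)
  | inr (inr a) => mu (a%:Z - n%:Z)
  end.

Definition data_point (C : fieldType) (n : nat) (A : 'M[C]_n)
    (lam mu : int -> C) (t : 'I_#|datum n|) : C :=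
  datum_val A lam mu (enum_val t).

(* The rational function f is regular at x, with value v there. *)
Definition specializes (C : fieldType) (N : nat) (x : 'I_N -> C)
    (f : {fraction {mpoly C[N]}}) (v : C) : Prop :=
  exists num den : {mpoly C[N]},
    [/\ den.@[x] != 0,
        f = FracField.tofrac num / FracField.tofrac den
      & v = num.@[x] / den.@[x]].

(* |A|_{lambda,mu} = v.  T_{0,0,n} is a rational function of the data (in fact
   Laurent polynomial in the entries, polynomial in the parameters), and
   |A|_{lambda,mu} is its value at the given data.  Running the recurrence on
   the given data itself may meet a division 0/0 (e.g. all entries 1,
   lambda_a = mu_a = (-1)^a, n = 5); when it does not, both procedures agree:
   see is_lambda_det_direct. *)
Definition is_lambda_det (C : fieldType) (n : nat) (A : 'M[C]_n)
    (lam mu : int -> C) (v : C) : Prop :=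
  specializes (data_point A lam mu) (Tgen C n 0 0 n) v.

(* The increasing list of the integers j with a <= j <= b. *)
Definition zrange (a b : int) : seq int :=
  if a <= b then [seq a + t%:Z | t <- iota 0 (absz (b - a)).+1] else [::].

Lemma zrange_uniq (a b : int) : uniq (zrange a b).
Proof.
rewrite /zrange; case: ifP => // _; rewrite map_inj_uniq ?iota_uniq //.
by move=> x y /addrI [].
Qed.

Lemma mem_zrange (a b j : int) : (j \in zrange a b) = (a <= j <= b).
Proof.
rewrite /zrange; case: ifP => [leab|/negbT]; last by rewrite in_nil; lia.
apply/mapP/idP => [[t]|/andP[leaj lejb]].
  by rewrite mem_iota => ht ->; lia.
by exists (absz (j - a)); rewrite ?mem_iota; lia.
Qed.

Lemma specializes_unique (C : fieldType) (N : nat) (x : 'I_N -> C)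
    (f : {fraction {mpoly C[N]}}) (v w : C) :
  specializes x f v -> specializes x f w -> v = w.
Proof.
move=> [p [q [q0 -> ->]]] [p' [q' [q'0 e ->]]].
have nz (s : {mpoly C[N]}) : s.@[x] != 0 -> FracField.tofrac s != 0.
  by move=> s0; rewrite tofrac_eq0; apply: contraNneq s0 => ->; rewrite meval0.
move/eqP: e; rewrite eqr_div ?nz // -!tofracM tofrac_eq => /eqP e.
by apply/eqP; rewrite eqr_div // -!mevalM e.
Qed.

Lemma is_lambda_det_unique (C : fieldType) (n : nat) (A : 'M[C]_n)
    (lam mu : int -> C) (v w : C) :
  is_lambda_det A lam mu v -> is_lambda_det A lam mu w -> v = w.
Proof. exact: specializes_unique. Qed.

Lemma specializes_tofrac (C : fieldType) (N : nat) (x : 'I_N -> C)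
    (p : {mpoly C[N]}) : specializes x (FracField.tofrac p) p.@[x].
Proof.
by exists p, 1; rewrite meval1 tofrac1 !divr1 oner_neq0.
Qed.

Lemma specializes_neq0 (C : fieldType) (N : nat) (x : 'I_N -> C)
    (f : {fraction {mpoly C[N]}}) (v : C) :
  specializes x f v -> v != 0 -> f != 0.
Proof.
move=> sf; apply: contraNneq => f0.
have := specializes_tofrac x 0; rewrite tofrac0 meval0 -f0.
by move/(specializes_unique sf) => ->.
Qed.

Lemma specializesD (C : fieldType) (N : nat) (x : 'I_N -> C)
    (f g : {fraction {mpoly C[N]}}) (v w : C) :
  specializes x f v -> specializes x g w -> specializes x (f + g) (v + w).
Proof.
move=> [p [q [q0 -> ->]]] [p' [q' [q'0 -> ->]]].
have nz (s : {mpoly C[N]}) : s.@[x] != 0 -> FracField.tofrac s != 0.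
  by move=> s0; rewrite tofrac_eq0; apply: contraNneq s0 => ->; rewrite meval0.
exists (p * q' + p' * q), (q * q'); rewrite mevalM mulf_neq0 //; split=> //.
  by rewrite tofracD !tofracM addf_div ?nz.
by rewrite mevalD !mevalM addf_div.
Qed.

Lemma specializesM (C : fieldType) (N : nat) (x : 'I_N -> C)
    (f g : {fraction {mpoly C[N]}}) (v w : C) :
  specializes x f v -> specializes x g w -> specializes x (f * g) (v * w).
Proof.
move=> [p [q [q0 -> ->]]] [p' [q' [q'0 -> ->]]].
exists (p * p'), (q * q').
by rewrite !mevalM mulf_neq0 // !tofracM !mulf_div.
Qed.

Lemma specializesV (C : fieldType) (N : nat) (x : 'I_N -> C)
    (f : {fraction {mpoly C[N]}}) (v : C) :
  v != 0 -> specializes x f v -> specializes x f^-1 v^-1.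
Proof.
move=> v0 [p [q [q0 ef ev]]]; exists q, p; rewrite ef ev !invf_div; split=> //.
by apply: contraNneq v0 => p0; rewrite ev p0 mul0r.
Qed.

Lemma specializes_gen (C : fieldType) (n : nat) (A : 'M[C]_n)
    (lam mu : int -> C) (d : datum n) :
  specializes (data_point A lam mu) (gen C d) (datum_val A lam mu d).
Proof.
have -> : datum_val A lam mu d =
    ('X_(enum_rank d) : genpoly C n).@[data_point A lam mu].
  by rewrite mevalXU /data_point enum_rankK.
exact: specializes_tofrac.
Qed.

Lemma Tgen_specializes (C : fieldType) (n : nat) (A : 'M[C]_n)
    (lam mu : int -> C) :
    (forall (i j : int) (k : nat), (`|i| + `|j| + k.+2 <= n)%N ->
       Tsys A lam mu i j k != 0) ->
  forall (i j : int) (k : nat), (`|i| + `|j| + k <= n)%N ->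
    specializes (data_point A lam mu) (Tgen C n i j k) (Tsys A lam mu i j k).
Proof.
move=> nz i j k; elim/ltn_ind: k i j => -[|[|k]] IH i j hk.
- rewrite /Tgen /= -tofrac1 -[X in specializes _ _ X](meval1 (data_point A lam mu)).
  exact: specializes_tofrac.
- rewrite /Tgen /= /entry.
  have h1 : specializes (data_point A lam mu) 1 1.
    rewrite -tofrac1 -[X in specializes _ _ X](meval1 (data_point A lam mu)).
    exact: specializes_tofrac.
  case: insub => [r|//]; case: insub => [c|//].
  by rewrite mxE; apply: specializes_gen.
have glam : specializes (data_point A lam mu) (gen_lam C n i) (lam i).
  have -> : lam i = datum_val A lam mu
      (inr (inl (inord (absz (i + n%:Z)))) : datum n).
    by rewrite /= inordK; [congr lam; lia | lia].
  exact: specializes_gen.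
have gmu : specializes (data_point A lam mu) (gen_mu C n j) (mu j).
  have -> : mu j = datum_val A lam mu
      (inr (inr (inord (absz (j + n%:Z)))) : datum n).
    by rewrite /= inordK; [congr mu; lia | lia].
  exact: specializes_gen.
have sT i' j' k' (hk' : (k' < k.+2)%N) (h : (`|i'| + `|j'| + k' <= n)%N) :
    specializes (data_point A lam mu)
      (Tsys (gen_mx C n) (@gen_lam C n) (@gen_mu C n) i' j' k')
      (Tsys A lam mu i' j' k') by apply: IH.
rewrite /Tgen !TsysSS; apply: specializesM.
  apply: specializesD; (apply: specializesM; first apply: specializesM) => //;
  by apply: sT; lia.
by apply: specializesV; [apply: nz | apply: sT]; lia.
Qed.

Lemma is_lambda_det_direct (C : fieldType) (n : nat) (A : 'M[C]_n)
    (lam mu : int -> C) :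
    (forall (i j : int) (k : nat), (`|i| + `|j| + k.+2 <= n)%N ->
       Tsys A lam mu i j k != 0) ->
  is_lambda_det A lam mu (Tsys A lam mu 0 0 n).
Proof. by move=> nz; apply: Tgen_specializes. Qed.

Lemma Tgen_neq0 (C : numFieldType) (n : nat) (i j : int) (k : nat) :
  (`|i| + `|j| + k <= n)%N -> Tgen C n i j k != 0.
Proof.
pose A : 'M[C]_n := const_mx 1; pose u (_ : int) : C := 1.
have pos i' j' k' : 0 < Tsys A u u i' j' k'.
  elim/ltn_ind: k' i' j' => -[|[|k']] IH i' j'; first exact: ltr01.
    by rewrite /= /entry; case: insub => [?|]; first case: insub => [?|];
      rewrite ?mxE ltr01.
  by rewrite TsysSS /u !mul1r divr_gt0 ?addr_gt0 ?mulr_gt0 ?IH.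
move=> h; have nz i' j' k' : Tsys A u u i' j' k' != 0 by rewrite gt_eqF.
exact: specializes_neq0 (Tgen_specializes (fun i' j' k' _ => nz i' j' k') h)
  (nz _ _ _).
Qed.

Lemma Tgen_recurrence (C : numFieldType) (n : nat) (i j : int) (k : nat) :
  (`|i| + `|j| + k.+2 <= n)%N ->
  Tgen C n i j k.+2 * Tgen C n i j k =
    gen_mu C n j * Tgen C n i (j + 1) k.+1 * Tgen C n i (j - 1) k.+1
  + gen_lam C n i * Tgen C n (i + 1) j k.+1 * Tgen C n (i - 1) j k.+1.
Proof.
move=> h; have nz : Tgen C n i j k != 0 by apply: Tgen_neq0; lia.
by rewrite [X in X * _]/Tgen TsysSS mulfVK.
Qed.

(* Main.v *)
(* Dividing [T] by suitable functions of [i] and [j] removes the coefficients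
   lambda and mu, and turns the recurrence into the octahedron recurrence
   [X_(m+2)(r,s) X_m(r+1,s+1)
      = X_(m+1)(r,s) X_(m+1)(r+1,s+1) + X_(m+1)(r+1,s) X_(m+1)(r,s+1)].
   As in Robbins and Rumsey, [X_n(0,0)] is the sum of [X_1^A X_0^(-B)] over the
   pairs of interlacing alternating sign matrices [A] (of size n) and [B] (of
   size n-1), encoded here by their corner sums.  The induction step rewrites
   this sum for [(X_1, X_2)] as the one for [(X_0, X_1)]: once the middle matrix
   is fixed, the larger and the smaller one are chosen cell by cell, and the
   sums over the two choices are compared in each cell.  Hence [T_{0,0,n}] is a
   Laurent polynomial in the data, and is regular wherever no datum vanishes,
   even if the recurrence itself meets 0/0 there.

   For [lambda_a = mu_a = q^a] with [q > 0] no division by zero occurs, and one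
   checks that [T_{i,j,k}] is the product over [1 <= m <= k/2] and
   [2m - k <= d <= k - 2m] of [q^i + q^(d+j)].  The identity to prove is an
   identity between Laurent polynomials in [q] true for all positive integers
   [q], hence for all [q != 0]. *)
Require Import Defs.
From mathcomp Require Import all_boot all_order all_algebra.
From mathcomp Require Import fraction mpoly complex reals boolp zify ring.
Import Order.TTheory GRing.Theory Num.Theory.
Local Open Scope ring_scope.
Set Implicit Arguments.
Unset Strict Implicit.

(** * Corner sums of alternating sign matrices *)

Definition mixed_diff (h : nat -> nat -> int) (p q : nat) : int :=
  h p.+1 q.+1 - h p q.+1 - h p.+1 q + h p q.

Section Heights.
Variable n : nat.
Implicit Types (a b c : nat -> nat -> int) (k : nat).

(* [a r s] stands for the sum of the entries of a [k * k] alternating sign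
   matrix in its first [r] rows and [s] columns, continued by zero entries to
   [0 <= r, s <= n].  Outside [0 < r, s < k] the matrix does not matter. *)
Definition frame k (r s : nat) : int := minn (minn r s) k.

Definition framed k a : Prop := forall r s, (r <= n)%N -> (s <= n)%N ->
  ~~ ((0 < r < k) && (0 < s < k))%N -> a r s = frame k r s.

Definition lipschitz k a : Prop := forall r s, (r < k)%N -> (s <= k)%N ->
  (a r s <= a r.+1 s <= a r s + 1) && (a s r <= a s r.+1 <= a s r + 1).

(* [b] has size [k] and [a] has size [k.+1]. *)
Definition interlaced k a b : Prop := forall r s, (r <= k)%N -> (s <= k)%N ->
  Num.max (a r s) (a r.+1 s.+1 - 1) <= b r s <= Num.min (a r.+1 s) (a r s.+1).

Definition pointwise (Q : nat -> nat -> pred int) a : Prop :=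
  forall r s, (r <= n)%N -> (s <= n)%N -> Q r s (a r s).

(* The arrays of size [k] and [k.+2] interlacing with [a], of size [k.+1], are
   those whose values are chosen independently of one another in the following
   intervals, which contain one or two integers when [a] is Lipschitz. *)
Definition below k a (r s : nat) : pred int := fun v =>
  if ((r <= k) && (s <= k))%N then
    Num.max (a r s) (a r.+1 s.+1 - 1) <= v <= Num.min (a r.+1 s) (a r s.+1)
  else v == frame k r s.

Definition above k a (r s : nat) : pred int := fun v =>
  if ((0 < r <= k.+1) && (0 < s <= k.+1))%N then
    Num.max (a r.-1 s) (a r s.-1) <= v <= Num.min (a r s) (a r.-1 s.-1 + 1)
  else v == frame k.+2 r s.

Lemma interlaced_lipschitz_lower k a b : interlaced k a b -> lipschitz k b.
Proof.
move=> ab r s rk sk.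
have := ab r s (ltnW rk) sk; have := ab r.+1 s rk sk.
by have := ab s r sk (ltnW rk); have := ab s r.+1 sk rk; lia.
Qed.

Lemma interlaced_lipschitz_upper k a b : (k < n)%N ->
  framed k.+1 a -> interlaced k a b -> lipschitz k.+1 a.
Proof.
move=> kn fa ab.
have rows r s : (r <= k)%N -> (s <= k.+1)%N ->
    (a r s <= a r.+1 s) && (a s r <= a s r.+1).
  rewrite [(s <= _)%N]leq_eqVlt => rk /predU1P[->|sk].
    by rewrite !fa /frame; lia.
  by have := ab r s; have := ab s r; lia.
have steps r s : (r <= k)%N -> (s <= k.+1)%N ->
    (a r.+1 s <= a r s + 1) && (a s r.+1 <= a s r + 1).
  case: s => [|s] rk sk; first by rewrite !fa /frame; lia.
  by have := ab r s; have := ab s r; lia.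
by move=> r s rk sk; have := rows r s; have := steps r s; lia.
Qed.

Lemma interlaced_below k a b : (k < n)%N ->
    framed k.+1 a -> lipschitz k.+1 a ->
  framed k b /\ interlaced k a b <-> pointwise (below k a) b.
Proof.
move=> kn fa la; split=> [[fb ab] r s rn sn|Qb].
  rewrite /below; case: ifPn => [/andP[rk sk]|rsk]; first exact: ab.
  by rewrite fb //; lia.
have ab : interlaced k a b.
  by move=> r s rk sk; have := Qb r s; rewrite /below rk sk; apply; lia.
split=> // r s rn sn rsk; have := Qb r s rn sn; rewrite /below.
case: ifPn => [/andP[rk sk]|_ /eqP //].
have [r0|[s0|[rE|sE]]] : r = 0%N \/ s = 0%N \/ r = k \/ s = k by lia.
- by rewrite (fa r s) 1?(fa r s.+1) /frame; lia.
- by rewrite (fa r s) 1?(fa r.+1 s) /frame; lia.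
- have := la s r ltac:(lia) ltac:(lia).
  by rewrite (fa r.+1 s) 1?(fa r.+1 s.+1) /frame; lia.
- have := la r s ltac:(lia) ltac:(lia).
  by rewrite (fa r s.+1) 1?(fa r.+1 s.+1) /frame; lia.
Qed.

Lemma interlaced_above k a c : (k.+1 < n)%N -> framed k.+1 a ->
  framed k.+2 c /\ interlaced k.+1 c a <-> pointwise (above k a) c.
Proof.
move=> kn fa; split=> [[fc ca] r s rn sn|Qc].
  rewrite /above; case: ifPn => [|rsk]; last by rewrite fc //; lia.
  case: r s rn sn => [|r] [|s] rn sn //= rsk; first by lia.
  have := ca r s; have := ca r.+1 s; have := ca r s.+1; have := ca r.+1 s.+1.
  by lia.
have fc : framed k.+2 c.
  by move=> r s rn sn rsk; have := Qc r s rn sn; rewrite /above ifF; lia.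
have cE r s : (r <= k)%N -> (s <= k)%N ->
    Num.max (a r s.+1) (a r.+1 s) <= c r.+1 s.+1
      <= Num.min (a r.+1 s.+1) (a r s + 1).
  by move=> rk sk; have := Qc r.+1 s.+1; rewrite /above ifT //=; lia.
have c_le_a r s : (r <= k.+1)%N -> (s <= k.+1)%N -> c r s <= a r s.
  case: r s => [|r] [|s] rk sk; try by rewrite fc ?fa /frame; lia.
  by have := cE r s; lia.
have a_le_c r s : (r <= k.+1)%N -> (s <= k.+1)%N ->
    (a r s <= c r.+1 s) && (a s r <= c s r.+1).
  case: s => [|s] rk sk; first by rewrite !fc ?fa /frame; lia.
  case: (ltnP r k.+1) => rk'; last by rewrite !fc ?fa /frame; lia.
  by have := cE r s; have := cE s r; lia.
have c_le_a1 r s : (r <= k.+1)%N -> (s <= k.+1)%N -> c r.+1 s.+1 <= a r s + 1.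
  move=> rk sk.
  case: (ltnP r k.+1) => rk'; last by rewrite fc ?fa /frame; lia.
  case: (ltnP s k.+1) => sk'; last by rewrite fc ?fa /frame; lia.
  by have := cE r s; lia.
split=> // r s rk sk; have := c_le_a r s rk sk; have := c_le_a1 r s rk sk.
by have := a_le_c r s rk sk; have := a_le_c s r sk rk; lia.
Qed.

Lemma mixed_diff_framed k a p q : framed k a -> (p < n)%N -> (q < n)%N ->
  ~~ ((p < k) && (q < k))%N -> mixed_diff a p q = 0.
Proof. by move=> fa pn qn pqk; rewrite /mixed_diff !fa /frame; lia. Qed.

End Heights.

(** * The Robbins-Rumsey expansion *)

Section OctahedronSums.
Variables (K : fieldType) (n : nat).
Implicit Types (Y Z : nat -> nat -> K) (E a b c : nat -> nat -> int) (k : nat).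

Local Notation framed := (framed n).
Local Notation pointwise := (pointwise n).
Local Notation height := {ffun 'I_n.+1 * 'I_n.+1 -> 'I_n.+1}.

Definition grid_prod Y E : K := \prod_(p < n) \prod_(q < n) Y p q ^ E p q.

Lemma eq_grid_prod Y Y' E E' :
    (forall p q, (p < n)%N -> (q < n)%N -> Y p q ^ E p q = Y' p q ^ E' p q) ->
  grid_prod Y E = grid_prod Y' E'.
Proof. by move=> e; do 2![apply: eq_bigr => ? _]; rewrite e. Qed.

Lemma grid_prodM Y Y' E :
  grid_prod (fun p q => Y p q * Y' p q) E = grid_prod Y E * grid_prod Y' E.
Proof.
rewrite /grid_prod -big_split; apply: eq_bigr => p _.
by rewrite -big_split; apply: eq_bigr => q _; rewrite expfzMl.
Qed.

Lemma grid_prodV Y E :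
  grid_prod (fun p q => (Y p q)^-1) E = (grid_prod Y E)^-1.
Proof.
rewrite /grid_prod -prodfV; apply: eq_bigr => p _.
by rewrite -prodfV; apply: eq_bigr => q _; rewrite exprz_inv invr_expz.
Qed.

Lemma prod_exprz_shift m (y : nat -> K) (e : nat -> int) :
    e 0%N = 0 -> e m = 0 ->
  \prod_(p < m) y p ^ e p = \prod_(p < m) y p.+1 ^ e p.+1.
Proof.
case: m => [|m] e0 em; first by rewrite !big_ord0.
by rewrite big_ord_recl [RHS]big_ord_recr /= e0 em !expr0z mul1r mulr1.
Qed.

Lemma grid_prod_shift_col Y E :
    (forall p, (p < n)%N -> E p 0%N = 0 /\ E p n = 0) ->
  grid_prod Y E = grid_prod (fun p q => Y p q.+1) (fun p q => E p q.+1).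
Proof.
move=> E0n; apply: eq_bigr => p _; have [E0 En] := E0n p (ltn_ord p).
exact: (prod_exprz_shift (Y p) E0 En).
Qed.

Lemma grid_prod_shift_row Y E :
    (forall q, (q < n)%N -> E 0%N q = 0 /\ E n q = 0) ->
  grid_prod Y E = grid_prod (fun p q => Y p.+1 q) (fun p q => E p.+1 q).
Proof.
move=> E0n; rewrite /grid_prod exchange_big [RHS]exchange_big.
apply: eq_bigr => q _; have [E0 En] := E0n q (ltn_ord q).
exact: (@prod_exprz_shift n (Y^~ q) (E^~ q)).
Qed.

Section NonzeroBase.
Variable Y : nat -> nat -> K.
Hypothesis Y_neq0 : forall p q, Y p q != 0.

Lemma grid_prod_neq0 E : grid_prod Y E != 0.
Proof. by do 2!apply/prodf_neq0 => ? _; rewrite expfz_neq0. Qed.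

Lemma grid_prodD E E' :
  grid_prod Y (fun p q => E p q + E' p q) = grid_prod Y E * grid_prod Y E'.
Proof.
rewrite /grid_prod -big_split; apply: eq_bigr => p _.
by rewrite -big_split; apply: eq_bigr => q _; rewrite expfzDr.
Qed.

Lemma grid_prodN E : grid_prod Y (fun p q => - E p q) = (grid_prod Y E)^-1.
Proof.
by rewrite -grid_prodV; apply: eq_grid_prod => p q _ _; rewrite exprz_inv.
Qed.

Definition cross_ratio p q : K :=
  Y p q * Y p.+1 q.+1 / (Y p.+1 q * Y p q.+1).

Lemma cross_ratio_neq0 p q : cross_ratio p q != 0.
Proof. by rewrite mulf_neq0 ?invr_neq0 ?mulf_neq0. Qed.

Lemma grid_prod_by_parts (h : nat -> nat -> int) :
    (forall r, (r <= n)%N ->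
       [/\ h r 0%N = 0, h 0%N r = 0, h r n = 0 & h n r = 0]) ->
  grid_prod Y (mixed_diff h) = grid_prod cross_ratio (fun p q => h p.+1 q.+1).
Proof.
move=> h0n.
have rowE : grid_prod Y (fun p q => h p q.+1) =
    grid_prod (fun p q => Y p.+1 q) (fun p q => h p.+1 q.+1).
  by apply: grid_prod_shift_row => q /h0n[].
have shift_colE Z : grid_prod Z (fun p q => h p.+1 q) =
    grid_prod (fun p q => Z p q.+1) (fun p q => h p.+1 q.+1).
  by apply: grid_prod_shift_col => p /h0n[].
have diagE : grid_prod Y h =
    grid_prod (fun p q => Y p.+1 q.+1) (fun p q => h p.+1 q.+1).
  by rewrite grid_prod_shift_row ?shift_colE // => q /ltnW/h0n[].
rewrite grid_prodM grid_prodV !grid_prodM -rowE -shift_colE -diagE invfM.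
rewrite -!grid_prodN -!grid_prodD; apply: eq_grid_prod => p q _ _.
by congr (_ ^ _); rewrite /mixed_diff; ring.
Qed.

Definition octa p q : K := Y p q * Y p.+1 q.+1 + Y p.+1 q * Y p q.+1.

Lemma octa_cross_ratio p q :
  octa p q = Y p.+1 q * Y p q.+1 * (1 + cross_ratio p q).
Proof. by rewrite /octa /cross_ratio; field; rewrite !Y_neq0. Qed.

End NonzeroBase.

Lemma grid_prod_interlaced Y k a b c :
    (forall p q, Y p q != 0) -> (k.+1 < n)%N ->
    framed k b -> framed k.+1 a -> framed k.+2 c ->
  grid_prod Y (mixed_diff c) *
    grid_prod (fun p q => Y p.+1 q.+1) (mixed_diff b) =
  grid_prod (fun p q => Y p.+1 q * Y p q.+1) (mixed_diff a) *
    grid_prod (cross_ratio Y)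
      (fun p q => c p.+1 q.+1 + b p q - a p.+1 q - a p q.+1).
Proof.
move=> Y_neq0 kn fb fa fc; rewrite grid_prodM.
pose b_diag r s := b r.-1 s.-1.
pose a_col r s := a r s.-1; pose a_row r s := a r.-1 s.
have -> : grid_prod (fun p q => Y p.+1 q.+1) (mixed_diff b) =
    grid_prod Y (mixed_diff b_diag).
  rewrite [RHS]grid_prod_shift_row => [|q qn]; last first.
    by split; rewrite /mixed_diff /b_diag ?fb /frame; lia.
  rewrite [RHS]grid_prod_shift_col // => p pn.
  by split; rewrite /mixed_diff /b_diag ?fb /frame; lia.
have <- : grid_prod Y (mixed_diff a_col) =
    grid_prod (fun p q => Y p q.+1) (mixed_diff a).
  rewrite grid_prod_shift_col // => p pn.
  by split; rewrite /mixed_diff /a_col ?fa /frame; lia.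
have <- : grid_prod Y (mixed_diff a_row) =
    grid_prod (fun p q => Y p.+1 q) (mixed_diff a).
  rewrite grid_prod_shift_row // => q qn.
  by split; rewrite /mixed_diff /a_row ?fa /frame; lia.
pose defect r s := c r s + b_diag r s - a_col r s - a_row r s.
rewrite -(grid_prod_by_parts Y_neq0 (h := defect)) => [|r rn]; last first.
  by split; rewrite /defect /b_diag /a_col /a_row fa ?fb ?fc ?fa /frame; lia.
rewrite -!grid_prodD //; apply: eq_grid_prod => p q _ _.
by congr (_ ^ _); rewrite /mixed_diff /defect; ring.
Qed.

Lemma grid_prod_framed0 Y b : framed 0 b -> grid_prod Y (mixed_diff b) = 1.
Proof.
move=> fb; apply: big1 => p _; apply: big1 => q _.
by rewrite (mixed_diff_framed fb) ?expr0z.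
Qed.

Lemma grid_prod_framed1 Y a : (0 < n)%N -> framed 1 a ->
  grid_prod Y (mixed_diff a) = Y 0%N 0%N.
Proof.
move=> n0 fa; pose i0 := Ordinal n0.
have neq0 (i : 'I_n) : i != i0 -> (i < 1)%N = false.
  by rewrite ltnS leqn0 => /negPf.
rewrite /grid_prod (bigD1 i0) //= [X in _ * X]big1 => [|p /neq0 p1]; last first.
  by apply: big1 => q _; rewrite (mixed_diff_framed fa) // p1.
rewrite mulr1 (bigD1 i0) //= big1 => [|q /neq0 q1]; last first.
  by rewrite (mixed_diff_framed fa) // q1 andbF.
have -> : mixed_diff a 0%N 0%N = 1 by rewrite /mixed_diff !fa.
by rewrite mulr1 expr1z.
Qed.

Lemma grid_prod_octa Y Z k a :
    (forall p q, Y p q != 0) ->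
    (forall p q, (p < k)%N -> (q < k)%N -> Z p q = octa Y p q) -> framed k a ->
  grid_prod Z (mixed_diff a) =
  grid_prod (fun p q => Y p.+1 q * Y p q.+1) (mixed_diff a) *
    grid_prod (fun p q => 1 + cross_ratio Y p q) (mixed_diff a).
Proof.
move=> Y_neq0 ZE fa; rewrite -grid_prodM; apply: eq_grid_prod => p q pn qn.
case: (boolP ((p < k) && (q < k)))%N => [/andP[pk qk]|pqk].
  by rewrite ZE // octa_cross_ratio.
by rewrite (mixed_diff_framed fa) // !expr0z.
Qed.

Definition hval (h : height) (r s : nat) : int :=
  (h (inord r, inord s) : nat)%:Z.

Lemma hval_range (h : height) r s : 0 <= hval h r s <= n%:Z.
Proof. by rewrite /hval; have := ltn_ord (h (inord r, inord s)); lia. Qed.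

Lemma sum_pointwise (Q : nat -> nat -> pred int) (F : nat -> nat -> int -> K) :
  \sum_(h : height | `[< pointwise Q (hval h) >])
     \prod_(r < n.+1) \prod_(s < n.+1) F r s (hval h r s) =
  \prod_(r < n.+1) \prod_(s < n.+1) \sum_(v < n.+1 | Q r s v%:Z) F r s v%:Z.
Proof.
rewrite [RHS]pair_big /= (bigA_distr_big_dep
  (fun (i : 'I_n.+1 * 'I_n.+1) (v : 'I_n.+1) => Q i.1 i.2 (v : nat)%:Z)
  (fun i v => F i.1 i.2 (v : nat)%:Z)).
apply: eq_big => [h|h _]; last first.
  by rewrite pair_big; apply: eq_bigr => -[r s] _; rewrite /hval !inord_val.
apply/asboolP/familyP => [Qh [r s]|Qh r s rn sn].
  by have := Qh r s (ltn_ord r) (ltn_ord s); rewrite /hval !inord_val.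
by have := Qh (inord r, inord s); rewrite /in_mem /= !inordK.
Qed.

Lemma prod_grid_low (G : nat -> nat -> K) :
    (forall r, (r <= n)%N -> G r 0%N = 1 /\ G 0%N r = 1) ->
  \prod_(r < n.+1) \prod_(s < n.+1) G r s =
  \prod_(p < n) \prod_(q < n) G p.+1 q.+1.
Proof.
move=> G1; rewrite big_ord_recl big1 => [|s _]; last first.
  by have [] := G1 s (ltn_ord s).
rewrite mul1r; apply: eq_bigr => p _.
by rewrite big_ord_recl (G1 _ (ltn_ord p)).1 mul1r.
Qed.

Lemma prod_grid_high (G : nat -> nat -> K) :
    (forall r, (r <= n)%N -> G r n = 1 /\ G n r = 1) ->
  \prod_(r < n.+1) \prod_(s < n.+1) G r s = \prod_(p < n) \prod_(q < n) G p q.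
Proof.
move=> G1; rewrite big_ord_recr /= [X in _ * X]big1 => [|s _]; last first.
  by have [] := G1 s (ltn_ord s).
rewrite mulr1; apply: eq_bigr => p _.
by rewrite big_ord_recr /= (G1 _ (ltnW (ltn_ord p))).1 mulr1.
Qed.

Lemma sum_ord_eq (F : int -> K) (l : int) :
  0 <= l <= n%:Z -> \sum_(v < n.+1 | v%:Z == l) F v%:Z = F l.
Proof.
move=> ln; have l_lt : (absz l < n.+1)%N by lia.
rewrite (big_pred1 (Ordinal l_lt)) => [|v /=]; first by congr F => /=; lia.
by rewrite -val_eqE /=; lia.
Qed.

Lemma sum_interval1 (F : int -> K) (l u : int) : 0 <= l <= n%:Z -> u = l ->
  \sum_(v < n.+1 | l <= v%:Z <= u) F v%:Z = F l.
Proof.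
by move=> ln ->; rewrite -(sum_ord_eq F ln); apply: eq_bigl => v; lia.
Qed.

Lemma sum_interval2 (F : int -> K) (l u : int) :
    0 <= l -> u <= n%:Z -> u = l + 1 ->
  \sum_(v < n.+1 | l <= v%:Z <= u) F v%:Z = F l + F u.
Proof.
move=> l0 un ul; rewrite (bigID (fun v : 'I_n.+1 => v%:Z == l)) /=.
rewrite -(sum_ord_eq F (l := l)) -?(sum_ord_eq F (l := u)); try lia.
by congr (_ + _); apply: eq_bigl => v; lia.
Qed.

(* The three cases correspond to an entry [d] of the alternating sign matrix
   equal to 0, 1 and -1. *)
Lemma sum_above_below_cell (x x1 x2 x3 : int) (w : K) :
    w != 0 -> 1 + w != 0 -> 0 <= x -> x3 <= n%:Z ->
    x <= x1 <= x + 1 -> x <= x2 <= x + 1 ->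
    x1 <= x3 <= x1 + 1 -> x2 <= x3 <= x2 + 1 ->
  \sum_(v < n.+1 | Num.max x2 x1 <= v%:Z <= Num.min x3 (x + 1))
     w ^ (v%:Z - x1 - x2) =
  (1 + w) ^ (x3 - x2 - x1 + x) *
    \sum_(v < n.+1 | Num.max x (x3 - 1) <= v%:Z <= Num.min x1 x2) w ^ (- v%:Z).
Proof.
move=> w0 w1 x_ge0 x3_le xx1 xx2 x13 x23; set d := x3 - x2 - x1 + x.
pose f v := w ^ (v - x1 - x2); pose g v := w ^ (- v).
have [d0|[d1|dN1]] : d = 0 \/ d = 1 \/ d = -1 by rewrite /d; lia.
- rewrite d0 expr0z mul1r (sum_interval1 f) ?(sum_interval1 g); try lia.
  by congr (_ ^ _); lia.
- rewrite d1 expr1z (sum_interval2 f) ?(sum_interval1 g); try lia.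
  rewrite mulrDl mul1r -[X in X * _]expr1z -expfzDr //.
  by congr (_ ^ _ + _ ^ _); lia.
- rewrite dN1 exprN1 (sum_interval1 f) ?(sum_interval2 g); try lia.
  apply: (canRL (mulKf w1)).
  rewrite mulrDl mul1r -[X in X * _]expr1z -expfzDr // addrC.
  by congr (_ ^ _ + _ ^ _); lia.
Qed.

Lemma sum_above_below k (a : nat -> nat -> int) p q (w : K) :
    (k.+1 < n)%N -> framed k.+1 a -> lipschitz k.+1 a ->
    (forall r s, 0 <= a r s <= n%:Z) -> w != 0 ->
    (p < n)%N -> (q < n)%N -> ((p <= k)%N -> (q <= k)%N -> 1 + w != 0) ->
  \sum_(v < n.+1 | above k a p.+1 q.+1 v%:Z) w ^ (v%:Z - a p.+1 q - a p q.+1) =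
  (1 + w) ^ mixed_diff a p q *
    \sum_(v < n.+1 | below k a p q v%:Z) w ^ (- v%:Z).
Proof.
move=> kn fa la an w0 pn qn w1.
case: (boolP ((p <= k) && (q <= k)))%N => [/andP[pk qk]|pqk].
  under eq_bigl do rewrite /above !ltnS !leq0n pk qk /=.
  under [in RHS]eq_bigl do rewrite /below pk qk /=.
  have := la p q; have := la q p; have := la p q.+1; have := la q p.+1.
  have := an p q; have := an p.+1 q.+1 => an1 an2 la1 la2 la3 la4.
  by rewrite /mixed_diff; apply: sum_above_below_cell => //; try lia; apply: w1.
rewrite (mixed_diff_framed fa) // expr0z mul1r.
under eq_bigl do rewrite /above !ltnS !leq0n /= (negPf pqk).
under [in RHS]eq_bigl do rewrite /below (negPf pqk).
rewrite (sum_ord_eq (fun v => w ^ (v - a p.+1 q - a p q.+1))).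
rewrite (sum_ord_eq (fun v => w ^ (- v))).
  by congr (_ ^ _); rewrite !fa /frame; lia.
all: by rewrite /frame; lia.
Qed.

Lemma sum_above_prod k a (F : nat -> nat -> int -> K) :
  \sum_(h : height | `[< pointwise (above k a) (hval h) >])
     \prod_(p < n) \prod_(q < n) F p q (hval h p.+1 q.+1) =
  \prod_(p < n) \prod_(q < n)
     \sum_(v < n.+1 | above k a p.+1 q.+1 v%:Z) F p q v%:Z.
Proof.
pose F' r s v := if (r, s) is (p.+1, q.+1) then F p q v else 1.
rewrite -[RHS](prod_grid_low (G := fun r s =>
  \sum_(v < n.+1 | above k a r s v%:Z) F' r s v%:Z)) => [|r rn]; last first.
  rewrite /above /F' andbF /=; case: r rn => [|r] rn /=.
    by split; apply: (sum_ord_eq (fun=> 1)); rewrite /frame; lia.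
  by split; apply: (sum_ord_eq (fun=> 1)); rewrite /frame; lia.
rewrite -sum_pointwise; apply: eq_bigr => h _.
by rewrite (prod_grid_low (G := fun r s => F' r s (hval h r s))) // => -[].
Qed.

Lemma sum_below_prod k a (F : nat -> nat -> int -> K) : (k < n)%N ->
  \sum_(h : height | `[< pointwise (below k a) (hval h) >])
     \prod_(p < n) \prod_(q < n) F p q (hval h p q) =
  \prod_(p < n) \prod_(q < n)
     \sum_(v < n.+1 | below k a p q v%:Z) F p q v%:Z.
Proof.
move=> kn; pose F' r s v := if (r < n)%N && (s < n)%N then F r s v else 1.
have F'E (p q : 'I_n) v : F' p q v = F p q v by rewrite /F' !ltn_ord.
under [RHS]eq_bigr do under eq_bigr do under eq_bigr do rewrite -F'E.
rewrite -[RHS](prod_grid_high (G := fun r s =>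
  \sum_(v < n.+1 | below k a r s v%:Z) F' r s v%:Z)) => [|r rn]; last first.
  have nk : (n <= k)%N = false by lia.
  rewrite /below /F' nk andbF ltnn andbF /=.
  by split; apply: (sum_ord_eq (fun=> 1)); rewrite /frame; lia.
rewrite -sum_pointwise; apply: eq_bigr => h _.
rewrite (prod_grid_high (G := fun r s => F' r s (hval h r s))) => [|r _].
  by do 2![apply: eq_bigr => ? _]; rewrite F'E.
by rewrite /F' ltnn andbF.
Qed.

Lemma sum_above_below_prod k a (w : nat -> nat -> K) :
    (k.+1 < n)%N -> framed k.+1 a -> lipschitz k.+1 a ->
    (forall r s, 0 <= a r s <= n%:Z) -> (forall p q, w p q != 0) ->
    (forall p q, (p <= k)%N -> (q <= k)%N -> 1 + w p q != 0) ->
  \sum_(c : height | `[< pointwise (above k a) (hval c) >])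
     grid_prod w (fun p q => hval c p.+1 q.+1 - a p.+1 q - a p q.+1) =
  grid_prod (fun p q => 1 + w p q) (mixed_diff a) *
  \sum_(b : height | `[< pointwise (below k a) (hval b) >])
     grid_prod w (fun p q => - hval b p q).
Proof.
move=> kn fa la an w0 w1.
rewrite (sum_above_prod _ _ (fun p q v => w p q ^ (v - a p.+1 q - a p q.+1))).
rewrite (sum_below_prod _ (fun p q v => w p q ^ (- v))) ?(ltnW kn) //.
rewrite -big_split; apply: eq_bigr => p _.
rewrite -big_split; apply: eq_bigr => q _ /=.
by apply: sum_above_below => //; apply: w1.
Qed.

Lemma grid_prod_interlaced_factors Y k a :
    (forall p q, Y p q != 0) -> (k.+1 < n)%N -> framed k.+1 a ->
  exists x : K,
    (forall c, framed k.+2 c -> grid_prod Y (mixed_diff c) =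
       x * grid_prod (fun p q => Y p.+1 q * Y p q.+1) (mixed_diff a) *
       grid_prod (cross_ratio Y)
         (fun p q => c p.+1 q.+1 - a p.+1 q - a p q.+1)) /\
    (forall b, framed k b ->
       (grid_prod (fun p q => Y p.+1 q.+1) (mixed_diff b))^-1 =
       x * grid_prod (cross_ratio Y) (fun p q => - b p q)).
Proof.
move=> Y_neq0 kn fa; pose w := cross_ratio Y.
have w0 p q : w p q != 0 := cross_ratio_neq0 Y_neq0 p q.
pose up c := grid_prod Y (mixed_diff c).
pose low b := grid_prod (fun p q => Y p.+1 q.+1) (mixed_diff b).
pose mid := grid_prod (fun p q => Y p.+1 q * Y p q.+1) (mixed_diff a).
pose cells c := grid_prod w (fun p q => c p.+1 q.+1 - a p.+1 q - a p q.+1).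
have up_low c b : framed k.+2 c -> framed k b ->
    up c * low b = mid * cells c * grid_prod w b.
  move=> fc fb; rewrite /up /low (grid_prod_interlaced Y_neq0 kn fb fa fc).
  rewrite -mulrA -grid_prodD //; congr (_ * _).
  by apply: eq_grid_prod => p q _ _; congr (_ ^ _); ring.
have low0 b : low b != 0 by apply: grid_prod_neq0.
have mid0 : mid != 0 by apply: grid_prod_neq0 => p q; rewrite mulf_neq0.
have cells0 c : cells c != 0 by apply: grid_prod_neq0.
have frame_framed m : framed m (frame m) by [].
pose x := up (frame k.+2) / (mid * cells (frame k.+2)).
have x_low b : framed k b -> x * low b = grid_prod w b.
  by move=> fb; rewrite /x mulrAC up_low // mulrC mulKf // mulf_neq0.
exists x; split=> [c fc|b fb].
  apply: (mulIf (low0 (frame k))); rewrite -/(up c) up_low // -x_low //.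
  by rewrite -/mid -/(cells c); ring.
rewrite -/(low b); apply: (mulIf (low0 b)); rewrite mulVf // mulrAC x_low //.
by rewrite grid_prodN mulfV // grid_prod_neq0.
Qed.

Lemma sum_interlaced Y Z k (a : height) :
    (forall p q, Y p q != 0) -> (forall p q, Z p q != 0) ->
    (forall p q, (p <= k)%N -> (q <= k)%N -> Z p q = octa Y p q) ->
    (k.+1 < n)%N -> framed k.+1 (hval a) ->
  \sum_(c : height | `[< framed k.+2 (hval c) /\
                         interlaced k.+1 (hval c) (hval a) >])
     grid_prod Y (mixed_diff (hval c)) =
  grid_prod Z (mixed_diff (hval a)) *
  \sum_(b : height | `[< framed k (hval b) /\ interlaced k (hval a) (hval b) >])
     (grid_prod (fun p q => Y p.+1 q.+1) (mixed_diff (hval b)))^-1.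
Proof.
move=> Y_neq0 Z_neq0 ZE kn fa; have kn' : (k < n)%N := ltnW kn.
have [la|not_la] := pselect (lipschitz k.+1 (hval a)); last first.
  rewrite big_pred0 => [|c]; last first.
    by apply/asboolPn => -[_ /interlaced_lipschitz_lower].
  rewrite big_pred0 ?mulr0 // => b.
  by apply/asboolPn => -[_ /(interlaced_lipschitz_upper kn' fa)].
have [x [upE lowE]] := grid_prod_interlaced_factors Y_neq0 kn fa.
under eq_bigr => c /asboolP[fc _] do rewrite upE //.
under [in RHS]eq_bigr => b /asboolP[fb _] do rewrite lowE //.
rewrite -!big_distrr /=.
under eq_bigl do rewrite (asbool_equiv_eq (interlaced_above _ kn fa)).
under [in RHS]eq_bigl do
  rewrite (asbool_equiv_eq (interlaced_below _ kn' fa la)).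
rewrite (grid_prod_octa (k := k.+1) Y_neq0 ZE fa)
  sum_above_below_prod //; first by ring.
- exact: hval_range.
- exact: cross_ratio_neq0.
move=> p q pk qk; have := Z_neq0 p q.
by rewrite ZE // octa_cross_ratio // mulf_eq0 negb_or => /andP[].
Qed.

Definition frame_height k : height :=
  [ffun i : 'I_n.+1 * 'I_n.+1 => inord (minn (minn i.1 i.2) k) : 'I_n.+1].

Lemma hval_frame_height k r s : (r <= n)%N -> (s <= n)%N ->
  hval (frame_height k) r s = frame k r s.
Proof. by move=> rn sn; rewrite /hval ffunE /= !inordK //; lia. Qed.

Lemma framed_le1 k (h : height) :
  (k <= 1)%N -> `[< framed k (hval h) >] = (h == frame_height k).
Proof.
move=> k1; apply/asboolP/eqP => [fh|-> r s rn sn _]; last first.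
  exact: hval_frame_height.
apply/ffunP => -[r s]; apply: val_inj.
have := fh r s (ltn_ord r) (ltn_ord s) ltac:(lia).
rewrite -(hval_frame_height k (ltn_ord r) (ltn_ord s)).
by rewrite /hval !inord_val => -[].
Qed.

Definition robbins_rumsey k (X0 X1 : nat -> nat -> K) : K :=
  \sum_(a : height | `[< framed k.+1 (hval a) >])
  \sum_(b : height | `[< framed k (hval b) /\ interlaced k (hval a) (hval b) >])
     grid_prod X1 (mixed_diff (hval a)) /
     grid_prod (fun p q => X0 p.+1 q.+1) (mixed_diff (hval b)).

Lemma robbins_rumsey0 X0 X1 :
  (0 < n)%N -> robbins_rumsey 0 X0 X1 = X1 0%N 0%N.
Proof.
move=> n0; rewrite /robbins_rumsey.
have framed_frame k : framed k (hval (frame_height k)).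
  by move=> r s rn sn _; apply: hval_frame_height.
rewrite (big_pred1 (frame_height 1)) => [|a]; last exact: framed_le1.
rewrite (big_pred1 (frame_height 0)) => [|b]; last first.
  rewrite -[RHS]framed_le1 //.
  apply/asboolP/asboolP => [[]|fb] //; split=> // r s.
  by rewrite !leqn0 => /eqP-> /eqP->; rewrite fb // !hval_frame_height.
by rewrite (grid_prod_framed1 _ n0) // grid_prod_framed0 // divr1.
Qed.

Lemma robbins_rumseyS k (X0 X1 X2 : nat -> nat -> K) :
    (forall r s, X0 r s != 0) -> (forall r s, X1 r s != 0) ->
    (forall r s, X2 r s != 0) -> (k.+1 < n)%N ->
    (forall r s, (r <= k)%N -> (s <= k)%N ->
       X2 r s * X0 r.+1 s.+1 = octa X1 r s) ->
  robbins_rumsey k X1 X2 = robbins_rumsey k.+1 X0 X1.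
Proof.
move=> X0_neq0 X1_neq0 X2_neq0 kn rec; pose Z p q := X2 p q * X0 p.+1 q.+1.
have Z_neq0 p q : Z p q != 0 by rewrite mulf_neq0.
rewrite /robbins_rumsey [RHS](exchange_big_dep
  (fun a : height => `[< framed k.+1 (hval a) >])) /=; last first.
  by move=> c a _ /asboolP[fa _]; apply/asboolP.
apply: eq_bigr => a /asboolP fa.
rewrite -big_distrr -big_distrl /=.
rewrite [in RHS](eq_bigl (fun c : height => `[< framed k.+2 (hval c) /\
    interlaced k.+1 (hval c) (hval a) >])); last first.
  move=> c; apply/andP/asboolP => [[/asboolP fc /asboolP[_ ca]]|[fc ca]] //.
  by split; apply/asboolP.
rewrite (sum_interlaced X1_neq0 Z_neq0 rec kn fa) grid_prodM mulrAC.
by rewrite mulfK // grid_prod_neq0.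
Qed.

Section Octahedron.
Variable X : nat -> nat -> nat -> K.
Hypothesis X_neq0 : forall m r s, X m r s != 0.
Hypothesis X_rec : forall m r s, (m.+2 + r <= n)%N -> (m.+2 + s <= n)%N ->
  X m.+2 r s * X m r.+1 s.+1 = octa (X m.+1) r s.

Lemma octahedron_expansion k m : (m + k < n)%N ->
  X (m + k).+1 0%N 0%N = robbins_rumsey k (X m) (X m.+1).
Proof.
elim: k m => [|k IH] m mkn.
  by rewrite addn0 robbins_rumsey0 //; lia.
rewrite addnS -addSn IH; last by lia.
apply: robbins_rumseyS => // [|r s rk sk]; first by lia.
by apply: X_rec; lia.
Qed.

Lemma octahedron_laurent (S : K -> Prop) :
    S 0 -> S 1 -> (forall x y, S x -> S y -> S (x + y)) ->
    (forall x y, S x -> S y -> S (x * y)) ->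
    (forall m r s, (m <= 1)%N -> S (X m r s) /\ S (X m r s)^-1) ->
  (0 < n)%N -> S (X n 0%N 0%N).
Proof.
move=> S0 S1 SD SM S01 n0.
have S_exp x m : S x -> S (x ^+ m).
  by move=> Sx; elim: m => [|m IH]; rewrite ?expr0 // exprS; apply: SM.
have S_grid_prod Y E :
    (forall p q, S (Y p q) /\ S (Y p q)^-1) -> S (grid_prod Y E).
  move=> SY; apply: (big_ind S) => // p _; apply: (big_ind S) => // q _.
  have [Sy Sy'] := SY p q.
  by case: (E p q) => m; [|rewrite NegzE -exprz_inv]; apply: S_exp.
rewrite -(prednK n0) -[n.-1]add0n octahedron_expansion ?add0n ?prednK //.
do 2![apply: (big_ind S) => // ? _]; apply: SM.
  by apply: S_grid_prod => p q; apply: S01.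
rewrite -grid_prodV; apply: S_grid_prod => p q; rewrite invrK.
by have [] := S01 0%N p.+1 q.+1.
Qed.

End Octahedron.

End OctahedronSums.

(** * Regularity of [T] at nonzero data *)

(* Dividing [T_{i,j,k}] by [gauge n lambda i * gauge n mu j] removes the
   coefficients from the recurrence. *)
Definition gauge (K : fieldType) (n : nat) (l : int -> K) (i : int) : K :=
  \prod_(s < absz (i + n%:Z)) \prod_(u < s) (l (u.+1%:Z - n%:Z))^-1.

Lemma gauge_recurrence (K : fieldType) (n : nat) (l : int -> K) (i : int) :
    - n%:Z < i -> l i != 0 ->
  l i * (gauge n l (i + 1) * gauge n l (i - 1)) = gauge n l i ^+ 2.
Proof.
move=> ni; rewrite /gauge; have [t iE] : {t : nat | i = t.+1%:Z - n%:Z}.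
  by exists (absz (i + n%:Z)).-1; lia.
have -> : absz (i + 1 + n%:Z) = t.+2 by lia.
have -> : absz (i - 1 + n%:Z) = t by lia.
have -> : absz (i + n%:Z) = t.+1 by lia.
by move=> l_neq0; rewrite !big_ord_recr /= -iE; field.
Qed.

Lemma gauge_cancel (K : fieldType) (a b g l f fN fP : K) :
    l != 0 -> g != 0 -> fN != 0 -> fP != 0 -> l * (fP * fN) = f ^+ 2 ->
  l * a * b / (g ^+ 2 * f ^+ 2) = b / (g * fN) * (a / (g * fP)).
Proof. by move=> l0 g0 fN0 fP0 <-; field; apply/and4P. Qed.

Section Regular.
Variables (C : fieldType) (N : nat) (x : 'I_N -> C).
Implicit Types f g : {fraction {mpoly C[N]}}.

Definition regular f : Prop := exists v, specializes x f v.

Definition regular_unit f : Prop := exists2 v, v != 0 & specializes x f v.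

Lemma regular_unit_regular f : regular_unit f -> regular f.
Proof. by case=> v _ sf; exists v. Qed.

Lemma regular0 : regular 0.
Proof. by exists 0; have := specializes_tofrac x 0; rewrite tofrac0 meval0. Qed.

Lemma regularD f g : regular f -> regular g -> regular (f + g).
Proof. by move=> [v sf] [w sg]; exists (v + w); apply: specializesD. Qed.

Lemma regularM f g : regular f -> regular g -> regular (f * g).
Proof. by move=> [v sf] [w sg]; exists (v * w); apply: specializesM. Qed.

Lemma regular_unit1 : regular_unit 1.
Proof.
exists 1; first exact: oner_neq0.
by have := specializes_tofrac x 1; rewrite tofrac1 meval1.
Qed.

Lemma regular_unitM f g :
  regular_unit f -> regular_unit g -> regular_unit (f * g).
Proof.
move=> [v v0 sf] [w w0 sg]; exists (v * w); first by rewrite mulf_neq0.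
exact: specializesM.
Qed.

Lemma regular_unitV f : regular_unit f -> regular_unit f^-1.
Proof.
move=> [v v0 sf]; exists v^-1; first by rewrite invr_neq0.
exact: specializesV.
Qed.

Lemma regular_unit_neq0 f : regular_unit f -> f != 0.
Proof. by move=> [v v0 sf]; apply: specializes_neq0 sf v0. Qed.

Lemma regular_unit_gauge n (l : int -> {fraction {mpoly C[N]}}) i :
  (forall j, regular_unit (l j)) -> regular_unit (gauge n l i).
Proof.
move=> ul; do 2![apply: (big_ind regular_unit) => [|f g|? _];
  [exact: regular_unit1 | exact: regular_unitM |]].
exact: regular_unitV.
Qed.

End Regular.

Section TgenRegular.
Variables (C : numFieldType) (n : nat) (A : 'M[C]_n) (lam mu : int -> C).
Hypotheses (A_neq0 : forall r c, A r c != 0) (lam_neq0 : forall a, lam a != 0)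
  (mu_neq0 : forall a, mu a != 0).

Let x := data_point A lam mu.

Lemma regular_unit_gen (d : datum n) : regular_unit x (gen C d).
Proof.
exists (datum_val A lam mu d); last exact: specializes_gen.
by case: d => [[r c]|[a|a]] /=.
Qed.

Let gauge_lam := gauge n (@gen_lam C n).
Let gauge_mu := gauge n (@gen_mu C n).

Lemma gauge_lam_regular_unit i : regular_unit x (gauge_lam i).
Proof. by apply: regular_unit_gauge => a; apply: regular_unit_gen. Qed.

Lemma gauge_mu_regular_unit j : regular_unit x (gauge_mu j).
Proof. by apply: regular_unit_gauge => a; apply: regular_unit_gen. Qed.

Lemma gen_neq0 (d : datum n) : gen C d != 0.
Proof. exact: regular_unit_neq0 (regular_unit_gen d). Qed.

Lemma gauge_lam_neq0 i : gauge_lam i != 0.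
Proof. exact: regular_unit_neq0 (gauge_lam_regular_unit i). Qed.

Lemma gauge_mu_neq0 j : gauge_mu j != 0.
Proof. exact: regular_unit_neq0 (gauge_mu_regular_unit j). Qed.

Definition Tgauged (i j : int) (k : nat) : genfrac C n :=
  Tgen C n i j k / (gauge_lam i * gauge_mu j).

Lemma Tgauged_recurrence i j k : (`|i| + `|j| + k.+2 <= n)%N ->
  Tgauged i j k.+2 * Tgauged i j k =
    Tgauged i (j - 1) k.+1 * Tgauged i (j + 1) k.+1 +
    Tgauged (i - 1) j k.+1 * Tgauged (i + 1) j k.+1.
Proof.
move=> ijk.
rewrite /Tgauged mulf_div Tgen_recurrence // mulrACA -!expr2 mulrDl.
have ni : - n%:Z < i by lia.
have nj : - n%:Z < j by lia.
congr (_ + _).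
  apply: (gauge_cancel _ _ (gen_neq0 _) (gauge_lam_neq0 _) (gauge_mu_neq0 _)
    (gauge_mu_neq0 _)).
  exact: gauge_recurrence nj (gen_neq0 _).
rewrite [gauge_lam i ^+ 2 * _]mulrC -!(mulrC (gauge_mu j)).
apply: (gauge_cancel _ _ (gen_neq0 _) (gauge_mu_neq0 _) (gauge_lam_neq0 _)
  (gauge_lam_neq0 _)).
exact: gauge_recurrence ni (gen_neq0 _).
Qed.

(* The value attached to the contiguous [m * m] block of the matrix whose top
   left entry is [(r, s)], counted from 0. *)
Definition block (m r s : nat) : genfrac C n :=
  if ((m + r <= n) && (m + s <= n))%N then
    Tgauged (s%:Z - r%:Z) ((r + s + m)%N%:Z - n%:Z) m
  else 1.

Lemma block_neq0 m r s : block m r s != 0.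
Proof.
rewrite /block; case: ifPn => [rs|_]; last exact: oner_neq0.
apply: mulf_neq0; first by apply: Tgen_neq0; lia.
exact: invr_neq0 (mulf_neq0 (gauge_lam_neq0 _) (gauge_mu_neq0 _)).
Qed.

Lemma block_octahedron m r s : (m.+2 + r <= n)%N -> (m.+2 + s <= n)%N ->
  block m.+2 r s * block m r.+1 s.+1 = octa (block m.+1) r s.
Proof.
move=> rn sn; rewrite /octa /block !ifT; try lia.
pose i : int := s%:Z - r%:Z; pose j : int := (r + s + m.+2)%N%:Z - n%:Z.
have -> : s.+1%:Z - r.+1%:Z = i by lia.
have -> : (r.+1 + s.+1 + m)%N%:Z - n%:Z = j by lia.
rewrite Tgauged_recurrence; last by lia.
by congr (Tgauged _ _ _ * Tgauged _ _ _ + Tgauged _ _ _ * Tgauged _ _ _); lia.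
Qed.

Lemma block_regular_unit m r s : (m <= 1)%N -> regular_unit x (block m r s).
Proof.
move=> m1; rewrite /block; case: ifPn => _; last exact: regular_unit1.
apply: regular_unitM; last first.
  apply/regular_unitV/regular_unitM; first exact: gauge_lam_regular_unit.
  exact: gauge_mu_regular_unit.
case: m m1 => [|[|//]] _; first exact: regular_unit1.
rewrite /Tgen /= /entry.
case: insub => [r'|]; last exact: regular_unit1.
case: insub => [c'|]; last exact: regular_unit1.
by rewrite mxE; apply: regular_unit_gen.
Qed.

Lemma Tgen_regular : (0 < n)%N -> regular x (Tgen C n 0 0 n).
Proof.
move=> n0.
have block_regular : regular x (block n 0 0).
  apply: (octahedron_laurent block_neq0 block_octahedron (S := regular x))
    => //.
  - exact: regular0.
  - exact/regular_unit_regular/regular_unit1.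
  - exact: regularD.
  - exact: regularM.
  - move=> m r s m1; have block_unit := block_regular_unit r s m1.
    by split; apply: regular_unit_regular => //; apply: regular_unitV.
have -> : Tgen C n 0 0 n = block n 0 0 * (gauge_lam 0 * gauge_mu 0).
  rewrite /block addn0 leqnn /= !add0n !subrr mulfVK //.
  exact: mulf_neq0 (gauge_lam_neq0 _) (gauge_mu_neq0 _).
apply: regularM block_regular (regular_unit_regular (regular_unitM _ _)).
  exact: gauge_lam_regular_unit.
exact: gauge_mu_regular_unit.
Qed.

End TgenRegular.

(** * The geometric data [q ^ a] *)

Section ClosedForm.
Variables (K : fieldType) (q : K).
Implicit Types x y : K.

Definition band (l : nat) x y : K :=
  \prod_(d <- zrange (- l%:Z) l%:Z) (x + q ^ d * y).

Definition band_prod (k : nat) x y : K :=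
  \prod_(1 <= m < (k./2).+1)
    \prod_(d <- zrange (2 * m%:Z - k%:Z) (k%:Z - 2 * m%:Z)) (x + q ^ d * y).

Lemma band0 x y : band 0 x y = x + y.
Proof. by rewrite /band big_seq1 mul1r. Qed.

Lemma bandS l x y :
  band l.+1 x y = band l x y * ((x + q ^+ l.+1 * y) * (x + q ^- l.+1 * y)).
Proof.
have zrangeS : perm_eq (zrange (- l.+1%:Z) l.+1%:Z)
    [:: l.+1%:Z, - l.+1%:Z & zrange (- l%:Z) l%:Z].
  apply: uniq_perm; rewrite ?zrange_uniq //.
    by rewrite /= !inE !mem_zrange zrange_uniq; lia.
  by move=> j; rewrite mem_zrange !in_cons mem_zrange; lia.
by rewrite /band (perm_big _ zrangeS) !big_cons exprnN -exprnP /=; ring.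
Qed.

Lemma band_prod_le1 k x y : (k <= 1)%N -> band_prod k x y = 1.
Proof. by case: k => [|[|//]] _; rewrite /band_prod big_geq. Qed.

Lemma band_prodSS k x y : band_prod k.+2 x y = band k x y * band_prod k x y.
Proof.
rewrite /band_prod big_ltn //= big_add1 /=; congr (_ * _).
  by apply: congr_big => //; congr zrange; lia.
by apply: eq_bigr => m _; apply: congr_big => //; congr zrange; lia.
Qed.

Lemma band_prod_homogeneous k : exists d, forall c x y,
  band_prod k (c * x) (c * y) = c ^+ d * band_prod k x y.
Proof.
exists (\sum_(1 <= m < (k./2).+1)
  \sum_(d <- zrange (2 * m%:Z - k%:Z) (k%:Z - 2 * m%:Z)) 1) => c x y.
rewrite expr_sum -big_split; apply: eq_bigr => m _ /=.
rewrite expr_sum -big_split; apply: eq_bigr => d _ /=.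
by rewrite expr1; ring.
Qed.

Hypothesis q_neq0 : q != 0.

Lemma band_shift l x y :
  band l.+1 x (q * y) * band l.+1 x (y / q) = band l.+2 x y * band l x y.
Proof.
elim: l => [|l IH]; first by rewrite !bandS !band0 !expr1 !expr2; field.
rewrite [band l.+2 x (q * y)]bandS [band l.+2 x (y / q)]bandS mulrACA IH.
rewrite [band l.+3 x y]bandS [band l.+1 x y]bandS [RHS]mulrACA.
congr (_ * _); rewrite !exprS; field.
by rewrite q_neq0 expf_neq0.
Qed.

Lemma band_prod_shift k x y :
  (x + y) * (band_prod k.+1 x (q * y) * band_prod k.+1 x (y / q)) =
  band_prod k.+2 x y * band_prod k x y.
Proof.
elim/ltn_ind: k => -[|[|k]] IH.
- by rewrite band_prodSS !band_prod_le1 // band0 !mulr1.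
- by rewrite !band_prodSS !band_prod_le1 // bandS !band0 !expr1; field.
rewrite [band_prod k.+3 x (q * y)]band_prodSS.
rewrite [band_prod k.+3 x (y / q)]band_prodSS.
rewrite [X in _ * X = _]mulrACA band_shift [LHS]mulrCA IH //.
by rewrite !band_prodSS; ring.
Qed.

Lemma band_prod_recurrence k x y :
  y * band_prod k.+1 x (q * y) * band_prod k.+1 x (y / q) +
  x * band_prod k.+1 (q * x) y * band_prod k.+1 (x / q) y =
  band_prod k.+2 x y * band_prod k x y.
Proof.
have [d scale] := band_prod_homogeneous k.+1.
have scale_qx : band_prod k.+1 (q * x) y = q ^+ d * band_prod k.+1 x (y / q).
  by rewrite -scale mulrCA divff // mulr1.
have scale_xq : q ^+ d * band_prod k.+1 (x / q) y = band_prod k.+1 x (q * y).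
  by rewrite -scale mulrCA divff // mulr1.
by rewrite scale_qx -band_prod_shift -scale_xq; ring.
Qed.

Lemma Tsys_band_prod (n : nat) :
    (forall k (i j : int), band_prod k (q ^ i) (q ^ j) != 0) ->
  forall k (i j : int),
    Tsys (const_mx 1 : 'M[K]_n) (fun a : int => q ^ a) (fun b : int => q ^ b)
      i j k = band_prod k (q ^ i) (q ^ j).
Proof.
move=> nz k; elim/ltn_ind: k => -[|[|k]] IH i j.
- by rewrite band_prod_le1.
- rewrite band_prod_le1 //= /entry.
  by case: insub => [r|//]; case: insub => [c|//]; rewrite mxE.
rewrite TsysSS !IH // !expfzDr // !exprN1 expr1z.
by rewrite ![_ * q]mulrC band_prod_recurrence mulfK.
Qed.

End ClosedForm.

Lemma band_prod_gt0 (C : numFieldType) (q x y : C) k :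
  0 < q -> 0 < x -> 0 < y -> 0 < band_prod q k x y.
Proof.
move=> q0 x0 y0; do 2![apply: prodr_gt0 => ? _].
by rewrite addr_gt0 ?mulr_gt0 ?exprz_gt0.
Qed.

Lemma is_lambda_det_band_prod (C : numFieldType) (n : nat) (q : C) : 0 < q ->
  is_lambda_det (const_mx 1 : 'M[C]_n) (fun a : int => q ^ a)
    (fun b : int => q ^ b) (band_prod q n 1 1).
Proof.
move=> q_gt0; have q_neq0 : q != 0 by rewrite gt_eqF.
have nz k (i j : int) : band_prod q k (q ^ i) (q ^ j) != 0.
  by rewrite gt_eqF // band_prod_gt0 ?exprz_gt0.
have TE := Tsys_band_prod q_neq0 n nz.
have := TE n 0 0; rewrite !expr0z => <-.
by apply: is_lambda_det_direct => i j k _; rewrite TE.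
Qed.

(** * Laurent polynomial functions *)

Section LaurentFunctions.
Variable C : numFieldType.
Implicit Types f g : C -> C.

Definition laurent f : Prop :=
  exists (p : {poly C}) (m : nat), forall t, t != 0 -> f t * t ^+ m = p.[t].

Lemma laurent_cst c : laurent (fun=> c).
Proof. by exists c%:P, 0%N => t _; rewrite hornerC expr0 mulr1. Qed.

Lemma laurent_exprz (a : int) : laurent (fun t => t ^ a).
Proof.
case: a => m; first by exists 'X^m, 0%N => t _; rewrite hornerXn expr0 mulr1.
exists 1, m.+1 => t t0.
by rewrite hornerC NegzE -exprnN mulVf // expf_neq0.
Qed.

Lemma laurentD f g : laurent f -> laurent g -> laurent (fun t => f t + g t).
Proof.
move=> [p [m fE]] [r [k gE]]; exists (p * 'X^k + r * 'X^m), (m + k)%N => t t0.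
by rewrite !hornerE -fE // -gE // exprD; ring.
Qed.

Lemma laurentM f g : laurent f -> laurent g -> laurent (fun t => f t * g t).
Proof.
move=> [p [m fE]] [r [k gE]]; exists (p * r), (m + k)%N => t t0.
by rewrite hornerM -fE // -gE // exprD mulrACA.
Qed.

Lemma laurentN f : laurent f -> laurent (fun t => - f t).
Proof.
by move=> [p [m fE]]; exists (- p), m => t t0; rewrite hornerN -fE // mulNr.
Qed.

Lemma laurent_big (op : C -> C -> C) (c : C) (I : Type) (s : seq I)
    (F : I -> C -> C) :
    (forall f g, laurent f -> laurent g -> laurent (fun t => op (f t) (g t))) ->
    (forall i, laurent (F i)) ->
  laurent (fun t => \big[op/c]_(i <- s) F i t).
Proof.
move=> laurent_op laurentF; elim: s => [|i s IH].
  by under eq_fun do rewrite big_nil; apply: laurent_cst.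
by under eq_fun do rewrite big_cons; apply: laurent_op.
Qed.

Lemma laurent_meval (N : nat) (x : C -> 'I_N -> C) (p : {mpoly C[N]}) :
  (forall i, laurent (fun t => x t i)) -> laurent (fun t => p.@[x t]).
Proof.
move=> laurentx; apply: laurent_big => [f g|m]; first exact: laurentD.
apply: laurentM; first exact: laurent_cst.
apply: laurent_big => [f g|i]; first exact: laurentM.
elim: (m i) => [|k IH]; first exact: laurent_cst 1.
by under eq_fun do rewrite exprS; apply: laurentM.
Qed.

Lemma laurent_eq0 f t : laurent f ->
  (forall m : nat, f m.+1%:R = 0) -> t != 0 -> f t = 0.
Proof.
move=> [p [k fE]] f0 t0.
have p0 : p = 0.
  apply: (@roots_geq_poly_eq0 _ p [seq m.+1%:R | m <- iota 0 (size p)]).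
  - apply/allP => _ /mapP[m _ ->].
    by rewrite /root -fE ?f0 ?mul0r // pnatr_eq0.
  - rewrite map_inj_uniq ?iota_uniq // => a b /eqP.
    by rewrite eqr_nat eqSS => /eqP.
  - by rewrite size_map size_iota.
have := fE t t0; rewrite p0 horner0 => /eqP.
by rewrite mulf_eq0 expf_eq0 (negPf t0) andbF orbF => /eqP.
Qed.

(* If [num / den] represents [f] near [x q], then [v t * den (x t) - num (x t)]
   is a Laurent polynomial in [t] vanishing at all positive integers. *)
Lemma specializes_laurent (N : nat) (x : C -> 'I_N -> C)
    (f : {fraction {mpoly C[N]}}) (v : C -> C) (q : C) :
    (forall i, laurent (fun t => x t i)) -> laurent v ->
    (forall m : nat, specializes (x m.+1%:R) f (v m.+1%:R)) ->
  q != 0 -> regular (x q) f -> specializes (x q) f (v q).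
Proof.
move=> laurentx laurentv fv q0 [_ [num [den [den_q fE _]]]].
have den0 : FracField.tofrac den != 0.
  by rewrite tofrac_eq0; apply: contraNneq den_q => ->; rewrite meval0.
exists num, den; split=> //; apply: (canRL (mulfK den_q)); apply/eqP.
rewrite -subr_eq0; apply/eqP.
pose g t := v t * den.@[x t] - num.@[x t].
have laurentg : laurent g.
  apply: laurentD; last exact/laurentN/laurent_meval.
  by apply: laurentM => //; apply: laurent_meval.
apply: (laurent_eq0 laurentg) q0 => m; apply/eqP; rewrite subr_eq0; apply/eqP.
have := specializesM (fv m) (specializes_tofrac (x m.+1%:R) den).
rewrite fE mulfVK // => /specializes_unique; apply.
exact: specializes_tofrac.
Qed.

End LaurentFunctions.

Lemma data_point_laurent (C : numFieldType) (n : nat) (d : 'I_#|datum n|) :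
  laurent (fun t : C => data_point (const_mx 1 : 'M[C]_n) (fun a : int => t ^ a)
    (fun b : int => t ^ b) d).
Proof.
rewrite /data_point; case: (enum_val d) => [[r c]|[a|b]] /=.
- by under eq_fun do rewrite mxE; apply: laurent_cst.
- exact: laurent_exprz.
- exact: laurent_exprz.
Qed.

Theorem theorem3p6 (R : realType) (n : nat) (q : R[i]) (hn : (1 <= n)%N)
    (hq : q != 0) :
  is_lambda_det (const_mx 1 : 'M[R[i]]_n) (fun a : int => q ^ a)
    (fun b : int => q ^ b)
    (\prod_(1 <= m < (n./2).+1)
       \prod_(j <- zrange (2 * m%:Z - n%:Z) (n%:Z - 2 * m%:Z)) (1 + q ^ j)).
Proof.
pose C : numFieldType := R[i].
pose x (t : C) :=
  data_point (const_mx 1 : 'M[C]_n) (fun a : int => t ^ a)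
    (fun b : int => t ^ b).
pose v (t : C) := \prod_(1 <= m < (n./2).+1)
  \prod_(j <- zrange (2 * m%:Z - n%:Z) (n%:Z - 2 * m%:Z)) (1 + t ^ j).
have vE t : v t = band_prod t n 1 1.
  by do 2![apply: eq_bigr => ? _]; rewrite mulr1.
apply: (specializes_laurent (x := x) (v := v) _ _ _ hq).
- exact: data_point_laurent.
- do 2![apply: laurent_big => [f g|?]; first exact: laurentM].
  by apply: laurentD; [apply: laurent_cst | apply: laurent_exprz].
- by move=> m; rewrite vE; apply: is_lambda_det_band_prod; apply: ltr0Sn.
by apply: Tgen_regular hn => [r c|a|b]; rewrite ?mxE ?oner_neq0 ?expfz_neq0.
Qed.
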